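(* For every integer $m\ge 3$, $\mathrm{gp}(\mathrm{Ka}(m,2))=\left\lfloor \frac{m^2}{3}\right\rfloor$.
   Context: For $m\ge 3$ and $k\ge 2$ the Kautz digraph $\mathrm{Ka}(m,k)$ has as vertices all words $a_1a_2\ldots a_k$ of length $k$ over an alphabet of $m$ characters such that no two consecutive characters are equal, with an arc from $a_1a_2\ldots a_k$ to every word $a_2\ldots a_kb$ with $b\ne a_k$. For a digraph $D$, a set $S\subseteq V(D)$ is in general position if for any $u,v\in S$ no shortest directed $u,v$-path in $D$ passes through a vertex of $S\setminus\{u,v\}$; the general position number $\mathrm{gp}(D)$ is the maximum cardinality of a general position set of $D$. *)

(* Defs.v *)
From HB Require Import structures.
From mathcomp Require Import all_boot.
From mathcomp Require Import boolp.

Set Implicit Arguments.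
Unset Strict Implicit.
Unset Printing Implicit Defensive.

(* A finite digraph is a finType of vertices with its arc relation. A path is
   given as in path.v by its first vertex u and the sequence p of the remaining
   vertices, so that [size p] is its length. *)
Section Digraph.
Variables (T : finType) (arc : rel T).

Definition directed_path (u v : T) (p : seq T) : bool :=
  [&& path arc u p, last u p == v & uniq (u :: p)].

Definition shortest_path (u v : T) (p : seq T) : Prop :=
  directed_path u v p /\
  forall q : seq T, directed_path u v q -> size p <= size q.

Definition general_position (S : {set T}) : Prop :=
  forall u v : T, u \in S -> v \in S ->
  forall p : seq T, shortest_path u v p ->
  forall w : T, w \in u :: p -> w \notin S :\: [set u; v].

Definition gp : nat := \max_(S : {set T} | `[< general_position S >]) #|S|.

End Digraph.

Definition kautz_vertex (m k : nat) : finType :=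
  {w : k.-tuple 'I_m | sorted (fun a b => a != b) w}.

(* The default value b of [last] is irrelevant for nonempty words. *)
Definition kautz (m k : nat) : rel (kautz_vertex m k) :=
  fun x y => [exists b : 'I_m,
    (b != last b (val x)) && (val y == rcons (behead (val x)) b :> seq 'I_m)].

(* Main.v *)
Require Import Defs.
From HB Require Import structures.
From mathcomp Require Import all_boot.
From mathcomp Require Import boolp.
From mathcomp Require Import zify.

(** A vertex [ab] of Ka(m,2) is an arc from [a] to [b] of the complete digraph
    on the m letters, and [x] has an arc to [y] when the head of [x] is the tail
    of [y]. Two distinct vertices [ab], [cd] that are not adjacent are joined by
    exactly one path of length 2, namely [ab, bc, cd]. Hence a vertex set is in
    general position iff every walk [ab, bc, cd] of three of its members
    satisfies [ab = cd] ([general_position_kautz2P]): seen as a digraph E on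
    the letters, it has no walk of length 3 except those that run back and
    forth along a 2-cycle.

    For the upper bound ([card_tight_le]), such a 2-cycle is isolated in E, so
    the p letters lying on 2-cycles carry only p arcs. Every other arc goes
    strictly upwards among three levels: the letters without in-arcs, those with
    both in-arcs and out-arcs, and those without out-arcs. If the levels have
    sizes a, b, c, then E has at most p + ab + ac + bc arcs, and with
    m = a + b + c + p this is at most m^2/3 as soon as m >= 3.

    For the lower bound, all arcs going upwards among three levels form a set in
    general position; residues modulo 3 give balanced levels, for which
    ab + ac + bc is the integer part of m^2/3. *)

Set Implicit Arguments.
Unset Strict Implicit.
Unset Printing Implicit Defensive.

(** * Digraphs whose walks of length 3 stay on one 2-cycle *)

Lemma levels_bound a b c p : 3 <= a + b + c + p ->
  3 * (p + (a * b + a * c + b * c)) <= (a + b + c + p) ^ 2.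
Proof.
move=> m3; set s := a + b + c.
have abc : 3 * (a * b + a * c + b * c) <= s ^ 2.
  have [ab _] := nat_Cauchy a b; have [ac _] := nat_Cauchy a c.
  have [bc _] := nat_Cauchy b c.
  by rewrite /s; nia.
(* The p letters add 3 p on the left and p (2 s + p) on the right, where
   2 s + p >= s + p >= 3. *)
have ps : p * 3 <= p * (2 * s + p) by rewrite leq_mul2l; lia.
have -> : (s + p) ^ 2 = s ^ 2 + p * (2 * s + p) by rewrite sqrnD mulnDr -mulnn; lia.
lia.
Qed.

Section ThreeWalks.
Variable V : finType.
Implicit Types (E : {set V * V}) (lev : V -> nat) (a b c d u v : V).

Definition tight E : Prop :=
  forall a b c d, (a, b) \in E -> (b, c) \in E -> (c, d) \in E ->
  (a, b) = (c, d).

Definition level lev (r : nat) : {set V} := [set v | lev v == r].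

(** The cut-off at 2 leaves higher levels free for letters that are to be
    treated separately. *)
Definition upward lev : {set V * V} :=
  [set e : V * V | lev e.1 < lev e.2 <= 2].

Lemma tight_upward lev : tight (upward lev).
Proof. by move=> a b c d; rewrite !inE /=; lia. Qed.

Lemma card_upward lev :
  #|upward lev| = #|level lev 0| * #|level lev 1| + #|level lev 0| * #|level lev 2|
                  + #|level lev 1| * #|level lev 2|.
Proof.
have -> : upward lev = setX (level lev 0) (level lev 1 :|: level lev 2)
                       :|: setX (level lev 1) (level lev 2).
  by apply/setP => -[u v]; rewrite !inE /=; lia.
rewrite cardsU cardsX cardsU cardsX.
have -> : setX (level lev 0) (level lev 1 :|: level lev 2)
          :&: setX (level lev 1) (level lev 2) = set0.
  by apply/setP => -[u v]; rewrite !inE /=; lia.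
have -> : level lev 1 :&: level lev 2 = set0.
  by apply/setP => v; rewrite !inE; lia.
by rewrite !cards0 !subn0 mulnDr.
Qed.

Lemma sum_card_levels lev : (forall v, lev v <= 3) ->
  #|level lev 0| + #|level lev 1| + #|level lev 2| + #|level lev 3| = #|V|.
Proof.
move=> lev3; rewrite -!sum1_card !(big_mkcond (fun v => v \in _)) -!big_split /=.
by apply: eq_bigr => v _; rewrite !inE; have := lev3 v; case: (lev v) => [|[|[|[|]]]].
Qed.

Definition on_2cycle E v := [exists u, ((u, v) \in E) && ((v, u) \in E)].

(** Level 3 collects the letters on 2-cycles, which [upward] ignores. *)
Definition walk_level E v : nat :=
  if on_2cycle E v then 3
  else if ~~ [exists u, (u, v) \in E] then 0
  else if [exists u, (v, u) \in E] then 1 else 2.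

Lemma walk_level_eq3 E v : (walk_level E v == 3) = on_2cycle E v.
Proof. by rewrite /walk_level; do !case: ifP. Qed.

Lemma walk_level_le3 E v : walk_level E v <= 3.
Proof. by rewrite /walk_level; do !case: ifP. Qed.

(** A 2-cycle [u, w] followed by [u, v] is a walk of length 3, so [v = w]. *)
Lemma card_arcs_from_2cycles E : tight E ->
  #|[set e in E | on_2cycle E e.1]| <= #|level (walk_level E) 3|.
Proof.
move=> tE; set X := [set e in E | _].
have injX : {in X &, injective fst}.
  move=> [u v] [u' v']; rewrite !inE /= => /andP[uvE /existsP[w /andP[wu uw]]].
  move=> /andP[uv'E _] eu; rewrite -{}eu in uv'E *.
  by have [<-] := tE _ _ _ _ uw wu uvE; have [<-] := tE _ _ _ _ uw wu uv'E.
rewrite -(card_in_imset injX); apply/subset_leq_card/subsetP => u.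
by case/imsetP => e; rewrite !inE walk_level_eq3 => /andP[_ ?] ->.
Qed.

(** The level-1 case is where walks of length 3 enter: if both ends of [(u, v)]
    had in-arcs and out-arcs, the walk [x, u, v, y] would put [u] on a
    2-cycle. *)
Lemma upward_arc E u v : tight E -> (u, v) \in E -> ~~ on_2cycle E u ->
  (u, v) \in upward (walk_level E).
Proof.
move=> tE uvE nPu.
have nPv : ~~ on_2cycle E v.
  apply: contra nPu => /existsP[w /andP[wv vw]].
  have [uw] := tE _ _ _ _ uvE vw wv.
  by apply/existsP; exists v; rewrite uvE uw vw.
have out_u : [exists y, (u, y) \in E] by apply/existsP; exists v.
have in_v : [exists x, (x, v) \in E] by apply/existsP; exists u.
rewrite inE /walk_level /= (negbTE nPu) (negbTE nPv) out_u in_v /=.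
have [/existsP[x xu]|_] := boolP [exists x, (x, u) \in E]; last by case: ifP.
have [/existsP[y vy]|//] := boolP [exists y, (v, y) \in E].
have [xv _] := tE _ _ _ _ xu uvE vy.
by case/negP: nPu; apply/existsP; exists v; rewrite uvE -xv xu.
Qed.

Lemma card_tight_le E : 3 <= #|V| -> tight E -> #|E| <= #|V| ^ 2 %/ 3.
Proof.
move=> V3 tE.
have sub : E \subset [set e in E | on_2cycle E e.1] :|: upward (walk_level E).
  apply/subsetP => -[u v] uvE; rewrite in_setU inE uvE /=.
  by case: (boolP (on_2cycle E u)) => // /(upward_arc tE uvE) ->.
have := leq_trans (subset_leq_card sub) (leq_card_setU _ _).
rewrite card_upward leq_divRL // [_ * 3]mulnC => cardE.
have cardP := card_arcs_from_2cycles tE.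
have sumV := sum_card_levels (walk_level_le3 E).
rewrite -sumV in V3 *; apply: leq_trans (levels_bound V3).
by rewrite leq_mul2l; apply: leq_trans cardE _; rewrite leq_add2r.
Qed.

End ThreeWalks.

Lemma card_residue_class m r : r < 3 ->
  #|level (fun i : 'I_m => i %% 3) r| = (m + 2 - r) %/ 3.
Proof.
move=> r3; rewrite /level cardsE -sum1_card big_mkcond /=.
elim: m => [|m IHm]; first by rewrite big_ord0; lia.
rewrite big_ord_recr /=.
by rewrite {}IHm !unfold_in /=; case: ifP => ?; lia.
Qed.

(** * Vertices of Ka(m,2) as arcs between letters *)

Section Kautz2.
Variable m : nat.
Implicit Types (x y z u v w : kautz_vertex m 2) (S : {set kautz_vertex m 2}).

Definition tail x : 'I_m := tnth (val x) ord0.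
Definition head x : 'I_m := tnth (val x) ord_max.
Definition ends x := (tail x, head x).

Lemma kautz2_word x : val x = [:: tail x; head x] :> seq 'I_m.
Proof. by rewrite /tail /head; case: x => -[[|a [|b [|]]] //]. Qed.

Lemma tail_neq_head x : tail x != head x.
Proof. by have := valP x; rewrite /= -/(val x) kautz2_word /= andbT. Qed.

Lemma ends_inj : injective ends.
Proof.
move=> x y [tE hE]; apply/val_inj/val_inj/(etrans (kautz2_word x)).
by rewrite tE hE -kautz2_word.
Qed.

Lemma ends_surj (a b : 'I_m) : a != b -> exists x, ends x = (a, b).
Proof.
move=> ab; have s_ab : sorted (fun a b => a != b) [tuple a; b] by rewrite /= ab.
by exists (exist _ [tuple a; b] s_ab).
Qed.

Lemma kautz2E x y : kautz x y = (head x == tail y).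
Proof.
apply/existsP/eqP => [[b]|hx]; rewrite !kautz2_word /=.
  by case/andP => _ /eqP[->].
by exists (head y); rewrite -hx eqxx andbT hx eq_sym tail_neq_head.
Qed.

Lemma ends_in S x : (ends x \in ends @: S) = (x \in S).
Proof. exact: (mem_imset _ _ ends_inj). Qed.

Lemma arc_neq x y : head x = tail y -> x != y.
Proof. by move=> xy; apply/eqP => e; have := tail_neq_head x; rewrite xy e eqxx. Qed.

Lemma short_directed_path u v : u != v ->
  exists2 q, directed_path (@kautz m 2) u v q & size q <= 2.
Proof.
move=> uv; have [uvA|uvN] := eqVneq (head u) (tail v).
  by exists [:: v]; rewrite // /directed_path /= kautz2E uvA inE uv !eqxx.
have [x [xt xh]] := ends_surj uvN.
exists [:: x; v] => //; rewrite /directed_path /= !kautz2E xt xh !eqxx !inE.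
by rewrite (negbTE uv) (negbTE (arc_neq (esym xt))) (negbTE (arc_neq xh)).
Qed.

(** Distances are at most 2, so only the midpoint of a path of length 2 can
    violate general position; conversely a walk [x, y, z] with [x <> z] is a
    shortest path, because [head x = tail y] differs from [head y = tail z]. *)
Lemma general_position_kautz2P S :
  general_position (@kautz m 2) S <->
  (forall x y z, x \in S -> y \in S -> z \in S ->
   head x = tail y -> head y = tail z -> x = z).
Proof.
split=> [gS x y z xS yS zS xy yz|S3 u v uS vS p [pP pmin] w wp].
  apply/eqP/negP => /negP xz.
  have/negP[] : y \notin S :\: [set x; z].
    apply: (gS x z xS zS [:: y; z]); last by rewrite !inE eqxx orbT.
    split=> [|q /and3P[pq /eqP lq _]].
      rewrite /directed_path /= !kautz2E xy yz !eqxx !inE.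
      by rewrite (negbTE xz) (negbTE (arc_neq xy)) (negbTE (arc_neq yz)).
    case: q pq lq => [_ /= e|t [|//]]; first by rewrite e eqxx in xz.
    rewrite /= andbT kautz2E => /eqP xt tz.
    by have := tail_neq_head y; rewrite -xy yz xt tz eqxx.
  by rewrite !inE yS eq_sym (negbTE (arc_neq xy)) (negbTE (arc_neq yz)).
apply/negP; rewrite !inE negb_or => /andP[/andP[wu wv] wS].
have uv : u != v.
  apply/eqP => uv; move: pP wp; rewrite -{}uv => /and3P[_].
  case: p {pmin} => [_ _|t p /eqP lp]; first by rewrite inE (negbTE wu).
  have utp : u \in t :: p.
    by have := mem_last t p; rewrite -[last t p]/(last u (t :: p)) lp.
  by rewrite cons_uniq utp.
have [q qP q2] := short_directed_path uv.
have {q qP q2}p2 := leq_trans (pmin q qP) q2.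
have{pP} /and3P[pP /eqP pl _] := pP.
case: p p2 {pmin} pP pl wp => [|a [|b [|//]]] _ /=.
- by move=> _ _; rewrite inE (negbTE wu).
- by move=> _ ->; rewrite !inE (negbTE wu) (negbTE wv).
rewrite andbT !kautz2E => /andP[/eqP ua /eqP ab] bv.
rewrite !inE (negbTE wu) bv (negbTE wv) orbF /= => /eqP wa.
by case/eqP: uv; apply: (S3 u w v) => //; rewrite wa // ab bv.
Qed.

Lemma general_position_tight S :
  general_position (@kautz m 2) S <-> tight (ends @: S).
Proof.
rewrite general_position_kautz2P; split=> [S3 a b c d|tS x y z xS yS zS xy yz].
  case/imsetP => x xS ex /imsetP[y yS ey] /imsetP[z zS ez].
  rewrite ex ez; case: ex ey ez => _ -> [xy ->] [yz _].
  by rewrite (S3 x y z).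
apply: ends_inj; apply: (tS _ (head x) (tail z)); rewrite ?ends_in //.
by rewrite xy -yz ends_in.
Qed.

End Kautz2.

Theorem theorem3p4 (m : nat) (hm : 3 <= m) : gp (@kautz m 2) = m ^ 2 %/ 3.
Proof.
apply/eqP; rewrite eqn_leq; apply/andP; split.
  apply/bigmax_leqP => S /asboolP/general_position_tight tS.
  have m3 : 3 <= #|'I_m| by rewrite card_ord.
  by have := card_tight_le m3 tS; rewrite card_ord (card_imset _ (@ends_inj m)).
pose U := upward (fun i : 'I_m => i %% 3).
pose S := [set x | ends x \in U].
have endsS : @ends m @: S = U.
  apply/setP => -[a b]; apply/imsetP/idP => [[x]|abU].
    by rewrite inE => + ->.
  have [|x ex] := @ends_surj m a b; last by exists x => //; rewrite inE ex.
  by apply/eqP => ab; move: abU; rewrite ab inE /= ltnn.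
have gS : `[< general_position (@kautz m 2) S >].
  by apply/asboolP/general_position_tight; rewrite endsS; apply: tight_upward.
apply: leq_trans (leq_bigmax_cond _ gS).
rewrite -(card_imset _ (@ends_inj m)) endsS card_upward !card_residue_class //.
(* With m = 3 q + r, the levels have size q, apart from r of them of size q + 1. *)
rewrite -ltnS ltn_divLR // (divn_eq m 3).
have : m %% 3 < 3 by rewrite ltn_pmod.
move: (m %/ 3) (m %% 3) => q r.
case: r => [|[|[|//]]] _.
- have -> : (q * 3 + 0 + 2 - 0) %/ 3 = q by lia.
  have -> : (q * 3 + 0 + 2 - 1) %/ 3 = q by lia.
  have -> : (q * 3 + 0 + 2 - 2) %/ 3 = q by lia.
  nia.
- have -> : (q * 3 + 1 + 2 - 0) %/ 3 = q.+1 by lia.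
  have -> : (q * 3 + 1 + 2 - 1) %/ 3 = q by lia.
  have -> : (q * 3 + 1 + 2 - 2) %/ 3 = q by lia.
  nia.
- have -> : (q * 3 + 2 + 2 - 0) %/ 3 = q.+1 by lia.
  have -> : (q * 3 + 2 + 2 - 1) %/ 3 = q.+1 by lia.
  have -> : (q * 3 + 2 + 2 - 2) %/ 3 = q by lia.
  nia.
Qed.
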